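(* Let $\mathfrak g$ be a Lie algebra with an abelian complex structure $J$. Then the following are equivalent: 1. $J$ is semisimple; 2. $B^{1,1}$ is non-degenerate and $\mathfrak g=\mathfrak n(\mathfrak g)\oplus J\mathfrak n(\mathfrak g)$ as vector spaces; 3. $\mathfrak g$ is the direct sum of $J$-simple ideals $\mathfrak k_i$. In particular, if any one of the equivalent conditions 1, 2, 3 holds (for instance, if $J$ is semisimple), then $\mathfrak g=\mathfrak g'\rtimes J\mathfrak g'$, and $J$-invariant ideals of $\mathfrak g$ and quotients of $\mathfrak g$ (by $J$-invariant ideals) are $J$-semisimple.
   Context: All Lie algebras are finite-dimensional and real; $\mathfrak g'=[\mathfrak g,\mathfrak g]$. A complex structure on $\mathfrak g$ is $J\in\mathrm{End}(\mathfrak g)$ with $J^2=-\mathrm{Id}$ and $[X,Y]+J[JX,Y]+J[X,JY]-[JX,JY]=0$ for all $X,Y$; it is abelian if $[JX,JY]=[X,Y]$ for all $X,Y$. $\mathfrak n(\mathfrak g)$ is the nilradical (maximal nilpotent ideal). $B(X,Y)=\mathrm{tr}(\mathrm{ad}_X\mathrm{ad}_Y)$ is the Killing form and $B^{1,1}(X,Y)=\frac12(B(X,Y)+B(JX,JY))$. $\mathfrak g$ is $J$-solvable if the series $\mathfrak g^{[0]}(J)=\mathfrak g$, $\mathfrak g^{[j+1]}(J)=[\mathfrak g^{[j]}(J),\mathfrak g^{[j]}(J)]+J[\mathfrak g^{[j]}(J),\mathfrak g^{[j]}(J)]$ reaches $0$; a $J$-solvable ideal is a $J$-invariant ideal that is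 $J$-solvable for the restricted complex structure. $J$ is semisimple ($\mathfrak g$ is $J$-semisimple) if $\mathfrak g$ has no non-zero $J$-solvable ideals. $J$ is simple ($\mathfrak g$ is $J$-simple) if $\mathfrak g$ is not abelian and has no $J$-invariant ideals other than $0$ and $\mathfrak g$. A $J$-simple ideal is a $J$-invariant ideal that is $J$-simple with the restricted complex structure. The zero algebra is regarded as $J$-semisimple and as an empty direct sum. $\mathfrak g=\mathfrak g'\rtimes J\mathfrak g'$ means $\mathfrak g=\mathfrak g'\oplus J\mathfrak g'$ as vector spaces, with $\mathfrak g'$ an ideal and $J\mathfrak g'$ a subalgebra. *)

(* Defs.v *)
From HB Require Import structures.
From mathcomp Require Import all_boot all_algebra.
From mathcomp Require Import generic_quotient ring_quotient reals.

Set Implicit Arguments.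
Unset Strict Implicit.
Unset Printing Implicit Defensive.

Import GRing.Theory passmx.
Local Open Scope ring_scope.
Local Open Scope quotient_scope.

(* The space of cosets of U in V. MathComp provides only its additive group;
   the scalar action and the finite dimension are added here.               *)
Section QuotientSpace.
Variables (K : fieldType) (V : vectType K) (U : {vspace V}).

Definition vquot : Type := Quotient.quot (pred_of_vspace U).

HB.instance Definition _ := GRing.Zmodule.on vquot.

Definition vpi (x : V) : vquot := \pi_(Quotient.quot (pred_of_vspace U)) x.
Definition vrepr (q : vquot) : V := @repr _ (Quotient.quot _) q.

Lemma vreprK : cancel vrepr vpi.
Proof. by move=> q; rewrite /vpi /vrepr reprK. Qed.

Lemma vpi_eqE (x y : V) : (vpi x == vpi y) = (x - y \in U).
Proof. by rewrite /vpi -Quotient.idealrBE. Qed.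

Lemma vpiP (x y : V) : reflect (vpi x = vpi y) (x - y \in U).
Proof. by rewrite -vpi_eqE; apply: eqP. Qed.

Lemma vrepr_vpi (x : V) : vrepr (vpi x) - x \in U.
Proof. by apply/vpiP; rewrite vreprK. Qed.

Lemma vpiD (x y : V) : vpi (x + y) = vpi x + vpi y.
Proof. exact: Quotient.pi_add. Qed.

Definition vquot_scale (a : K) (q : vquot) : vquot := vpi (a *: vrepr q).

Lemma vpi_scale (a : K) (x : V) : vquot_scale a (vpi x) = vpi (a *: x).
Proof. by apply/vpiP; rewrite -scalerBr rpredZ ?vrepr_vpi. Qed.

Fact vquot_scaleA a b q :
  vquot_scale a (vquot_scale b q) = vquot_scale (a * b) q.
Proof. by rewrite -[q]vreprK !vpi_scale scalerA. Qed.

Fact vquot_scale1 : left_id 1 vquot_scale.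
Proof. by move=> q; rewrite -[q]vreprK vpi_scale scale1r. Qed.

Fact vquot_scaleDr : right_distributive vquot_scale +%R.
Proof.
move=> a q r; rewrite -[q]vreprK -[r]vreprK.
by rewrite -vpiD !vpi_scale -vpiD scalerDr.
Qed.

Fact vquot_scaleDl q : {morph vquot_scale^~ q : a b / a + b}.
Proof. by move=> a b; rewrite -[q]vreprK !vpi_scale -vpiD scalerDl. Qed.

HB.instance Definition _ := GRing.Zmodule_isLmodule.Build K vquot
  vquot_scaleA vquot_scale1 vquot_scaleDr vquot_scaleDl.

Lemma vpi_is_linear : linear vpi.
Proof. by move=> a x y; rewrite vpiD -vpi_scale. Qed.

HB.instance Definition _ := GRing.isSemilinear.Build K V vquot _ vpi
  (GRing.semilinear_linear vpi_is_linear).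

(* Coordinates of a coset: those of its unique member in U^C. *)
Fact vquot_vect_iso : Vector.axiom (\dim {: subvs_of U^C}) vquot.
Proof.
pose c (x : V) := x - projv U x.
have cC x : c x \in (U^C)%VS by apply: memv_projC.
have c_lin : linear c.
  by move=> a x y; rewrite /c linearP scalerBr opprD addrACA.
have c_vpi x : c (vrepr (vpi x)) = c x.
  have /projv_id := vrepr_vpi x; set r := vrepr _ => Er.
  rewrite /c -[r](subrK x) linearD /= Er.
  by rewrite opprD addrACA subrr add0r.
have vpi_c x : vpi (c x) = vpi x.
  by apply/vpiP; rewrite /c addrAC subrr add0r rpredN memv_proj.
have c_id x : x \in (U^C)%VS -> c x = x.
  by rewrite -lker_proj memv_ker => /eqP; rewrite /c => ->; rewrite subr0.
pose e := vbasis {: subvs_of U^C}.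
have eB : basis_of {: subvs_of U^C} e := vbasisP _.
exists (fun q => rVof e (vsproj (U^C)%VS (c (vrepr q)))).
  move=> a q r; rewrite -[q]vreprK -[r]vreprK -linearP !c_vpi c_lin.
  by rewrite !linearP.
exists (fun w => vpi (vsval (vecof e w))) => [q|w].
  by rewrite rVofK // vsprojK // vpi_c vreprK.
by rewrite c_vpi c_id ?subvsP // vsvalK vecofK.
Qed.

HB.instance Definition _ := Lmodule_hasFinDim.Build K vquot vquot_vect_iso.

End QuotientSpace.

Section LieAlgebra.
Variables (K : fieldType) (V : vectType K).
Implicit Types (br : V -> V -> V) (J : 'End(V)) (U W : {vspace V}).

Record is_lie_bracket br : Prop := IsLieBracket {
  lie_linearl : forall y, linear (br^~ y);
  lie_linearr : forall x, linear (br x);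
  lie_alt : forall x, br x x = 0;
  lie_jacobi : forall x y z,
    br x (br y z) + br y (br z x) + br z (br x y) = 0 }.

Record is_complex_structure br J : Prop := IsComplexStructure {
  cplx_sqr : forall x, J (J x) = - x;
  cplx_integrable : forall x y,
    br x y + J (br (J x) y) + J (br x (J y)) - br (J x) (J y) = 0 }.

Definition is_abelian_complex_structure br J : Prop :=
  is_complex_structure br J /\ forall x y, br (J x) (J y) = br x y.

(* It suffices to span by brackets of basis vectors, see brv_subP. *)
Definition brv br U W : {vspace V} :=
  <<[seq br u w | u <- vbasis U, w <- vbasis W]>>%VS.

Definition derived br : {vspace V} := brv br fullv fullv.

Definition is_abelian br : Prop := forall x y, br x y = 0.

Definition is_subalgebra br U : Prop :=
  forall x y, x \in U -> y \in U -> br x y \in U.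

Definition is_ideal br U : Prop := forall x y, y \in U -> br x y \in U.

Definition J_invariant J U : Prop := (J @: U <= U)%VS.

Definition is_J_ideal br J U : Prop := is_ideal br U /\ J_invariant J U.

(* The Lie algebra and complex structure that a subalgebra, or a J-invariant
   one, inherits. The values are junk if U is not closed under br, resp. J. *)
Definition sub_br br U (x y : subvs_of U) : subvs_of U :=
  vsproj U (br (vsval x) (vsval y)).

Definition sub_J J U : 'End(subvs_of U) :=
  linfun (vsproj U \o J \o vsval).

(* The same on V / U; they do not depend on the chosen representatives when
   U is an ideal, resp. J-invariant (see quot_brE and quot_JE).            *)
Definition quot_br br U (p q : vquot U) : vquot U :=
  vpi U (br (vrepr p) (vrepr q)).

Definition quot_J J U : 'End(vquot U) :=
  linfun (fun q : vquot U => vpi U (J (vrepr q))).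

Definition lower_central br (k : nat) : {vspace V} :=
  iter k (brv br fullv) fullv.

Definition is_nilpotent br : Prop := exists k, lower_central br k = 0%VS.

Definition J_derived_series br J (j : nat) : {vspace V} :=
  iter j (fun U => brv br U U + J @: brv br U U)%VS fullv.

Definition is_J_solvable br J : Prop :=
  exists j, J_derived_series br J j = 0%VS.

Definition is_J_simple br J : Prop :=
  ~ is_abelian br /\
  forall U, is_J_ideal br J U -> U = 0%VS \/ U = fullv.

Definition ad br (x : V) : 'End(V) := linfun (br x).

Definition lfun_tr (f : 'End(V)) : K :=
  \tr (mxof (vbasis {:V}) (vbasis {:V}) f).

Definition killing br (x y : V) : K := lfun_tr (ad br x \o ad br y)%VF.

Definition killing11 br J (x y : V) : K :=
  2%:R^-1 * (killing br x y + killing br (J x) (J y)).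

(* One-sided, as the only form it is used for is symmetric. *)
Definition nondegenerate_form (B : V -> V -> K) : Prop :=
  forall x, (forall y, B x y = 0) -> x = 0.

End LieAlgebra.

Section Ideals.
Variables (K : fieldType) (V : vectType K).
Implicit Types (br : V -> V -> V) (J : 'End(V)) (U N : {vspace V}).

Definition is_nilpotent_ideal br U : Prop :=
  is_ideal br U /\ is_nilpotent (sub_br br (U := U)).

(* The largest nilpotent ideal (a sum of nilpotent ideals being nilpotent, a
   maximal one is the largest); unique by is_nilradical_uniq.              *)
Definition is_nilradical br N : Prop :=
  is_nilpotent_ideal br N /\
  forall U, is_nilpotent_ideal br U -> (U <= N)%VS.

Definition is_J_solvable_ideal br J U : Prop :=
  is_J_ideal br J U /\ is_J_solvable (sub_br br (U := U)) (sub_J J U).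

Definition is_J_simple_ideal br J U : Prop :=
  is_J_ideal br J U /\ is_J_simple (sub_br br (U := U)) (sub_J J U).

Definition is_J_semisimple br J : Prop :=
  forall U, is_J_solvable_ideal br J U -> U = 0%VS.

Definition is_sum_of_J_simple_ideals br J : Prop :=
  exists (n : nat) (k : 'I_n -> {vspace V}),
    [/\ forall i, is_J_simple_ideal br J (k i),
        (\sum_(i < n) k i)%VS = fullv
      & directv (\sum_(i < n) k i)].

(* V = A \rtimes B: A is the normal factor. *)
Definition is_semidirect br (A B : {vspace V}) : Prop :=
  [/\ is_ideal br A, is_subalgebra br B, (A + B)%VS = fullv
    & directv (A + B)].

Lemma is_nilradical_uniq br N N' :
  is_nilradical br N -> is_nilradical br N' -> N = N'.
Proof.
move=> [nilN maxN] [nilN' maxN']; apply: subv_anti.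
by rewrite maxN' ?maxN.
Qed.

End Ideals.

Section Inherited.
Variables (K : fieldType) (V : vectType K) (br : V -> V -> V) (J : 'End(V)).
Hypothesis lieP : is_lie_bracket br.

Let brDl x y z : br (x + y) z = br x z + br y z.
Proof. by have := lie_linearl lieP z 1 x y; rewrite !scale1r. Qed.
Let brDr x y z : br x (y + z) = br x y + br x z.
Proof. by have := lie_linearr lieP x 1 y z; rewrite !scale1r. Qed.

Lemma lie_anti x y : br x y = - br y x.
Proof.
apply/eqP; rewrite -addr_eq0; apply/eqP; have := lie_alt lieP (x + y).
by rewrite brDl !brDr !(lie_alt lieP) add0r addr0.
Qed.

Lemma brv_subP (U W : {vspace V}) (S : {vspace V}) :
  reflect (forall u w, u \in U -> w \in W -> br u w \in S)
          (brv br U W <= S)%VS.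
Proof.
have Z0 a x y : br (a *: x) y = a *: br x y.
  have := lie_linearl lieP y a x 0; rewrite !addr0 => ->.
  suff -> : br 0 y = 0 by rewrite addr0.
  by have := brDl 0 0 y; rewrite addr0 -[LHS]addr0 => /addrI.
have brC x y : br x y \in S -> br y x \in S by rewrite lie_anti rpredN.
have Z1 a x y : br x (a *: y) = a *: br x y.
  by rewrite lie_anti Z0 -scalerN -lie_anti.
have S0 x : br x 0 = 0 by have := Z1 0 x 0; rewrite !scale0r.
apply: (iffP span_subvP) => [sub u w uU wW | sub v /allpairsP[[u w] /= []]].
  rewrite (coord_vbasis uU) (coord_vbasis wW).
  elim/big_rec: _ => [|i y _ yS]; first by rewrite lie_anti S0 oppr0 mem0v.
  rewrite brDl rpredD // Z0 rpredZ //.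
  elim/big_rec: _ => [|j z _ zS]; first by rewrite S0 mem0v.
  rewrite brDr rpredD // Z1 rpredZ //; apply: sub.
  by apply/allpairsP; exists ((vbasis U)`_i, (vbasis W)`_j); rewrite !mem_nth ?size_tuple.
by move=> /vbasis_mem uU /vbasis_mem wW ->; apply: sub.
Qed.

Section Sub.
Variable U : {vspace V}.
Hypothesis subU : is_subalgebra br U.

Lemma sub_brE (x y : subvs_of U) : vsval (sub_br br x y) = br (vsval x) (vsval y).
Proof. by rewrite vsprojK // subU ?subvsP. Qed.

Lemma sub_br_lie : is_lie_bracket (sub_br br (U := U)).
Proof.
split=> [z a x y|x a y z|x|x y z]; apply: val_inj; rewrite /= !sub_brE /=.
- by rewrite (lie_linearl lieP).
- by rewrite (lie_linearr lieP).
- by rewrite (lie_alt lieP).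
- by rewrite (lie_jacobi lieP).
Qed.

Lemma sub_JE (x : subvs_of U) :
  J_invariant J U -> vsval (sub_J J U x) = J (vsval x).
Proof.
move=> JU; rewrite lfunE /= vsprojK //.
by apply: (subvP JU); rewrite memv_img ?subvsP.
Qed.

Lemma sub_J_complex : J_invariant J U ->
  is_complex_structure br J ->
  is_complex_structure (sub_br br (U := U)) (sub_J J U).
Proof.
move=> JU cJ; split=> [x|x y]; apply: val_inj => /=.
  by rewrite !sub_JE // (cplx_sqr cJ).
by rewrite !(sub_JE, sub_brE) // (cplx_integrable cJ).
Qed.

End Sub.

Section Quot.
Variable U : {vspace V}.
Hypothesis idU : is_ideal br U.

Lemma quot_brE (x y : V) : quot_br br (vpi U x) (vpi U y) = vpi U (br x y).
Proof.
apply/vpiP; set x' := vrepr _; set y' := vrepr _.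
have xU : x' - x \in U := vrepr_vpi _ _; have yU : y' - y \in U := vrepr_vpi _ _.
have -> : br x' y' = br (x' - x) y' + br x y' by rewrite -brDl subrK.
have -> : br x y' = br x (y' - y) + br x y by rewrite -brDr subrK.
rewrite addrA addrK.
by apply: rpredD; [rewrite lie_anti rpredN; apply: idU | apply: idU].
Qed.

Lemma quot_br_lie : is_lie_bracket (quot_br br (U := U)).
Proof.
split=> [z a x y|x a y z|x|x y z]; rewrite -1?[x]vreprK -1?[y]vreprK -1?[z]vreprK.
- by rewrite -linearP !quot_brE (lie_linearl lieP) linearP.
- by rewrite -linearP !quot_brE (lie_linearr lieP) linearP.
- by rewrite quot_brE (lie_alt lieP) linear0.
- by rewrite !quot_brE -!linearD (lie_jacobi lieP) linear0.
Qed.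

Hypothesis JU : J_invariant J U.

Lemma quot_JE (x : V) : quot_J J U (vpi U x) = vpi U (J x).
Proof.
have E y : vpi U (J (vrepr (vpi U y))) = vpi U (J y).
  by apply/vpiP; rewrite -linearB (subvP JU) // memv_img // vrepr_vpi.
have lin : linear (fun q : vquot U => vpi U (J (vrepr q))).
  move=> a q r; rewrite -[q]vreprK -[r]vreprK -linearP !E.
  by rewrite !linearP.
pose f := GRing.isSemilinear.Build _ _ _ _ _ (GRing.semilinear_linear lin).
pose F : {linear vquot U -> vquot U} := HB.pack (fun q : vquot U => vpi U (J (vrepr q))) f.
by rewrite /quot_J -[LHS]/(linfun F _) lfunE /= E.
Qed.

Lemma quot_J_complex :
  is_complex_structure br J ->
  is_complex_structure (quot_br br (U := U)) (quot_J J U).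
Proof.
move=> cJ; split=> [x|x y]; rewrite -1?[x]vreprK -1?[y]vreprK.
  by rewrite !quot_JE (cplx_sqr cJ) linearN.
rewrite !(quot_JE (vrepr _)) !quot_brE !quot_JE -[RHS](linear0 (vpi U)).
by rewrite -(cplx_integrable cJ (vrepr x) (vrepr y)) linearB !linearD.
Qed.

End Quot.

End Inherited.

(* Main.v *)
(* On A = g' the product a . b = [J a, b] is commutative because J is abelian,
   and associative because g' is abelian; moreover every ad x acts A-linearly
   on A. If an ideal I of g lies in A, then I + JI is a J-invariant ideal of g,
   and it is abelian when I . I = 0. As the J-derived series of a J-solvable
   ideal ends in an abelian J-invariant ideal, J is semisimple exactly when g
   has no such ideal other than 0, and then A is reduced, hence regular:
   every a has the form a . a . x. Consequently every ideal of g inside A has a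
   unit e, and x - J[x,e] - [Jx,e] centralises I + JI for every x in g, so that
   J-invariant ideals are direct factors and g = A + JA. Finally, if
   b = b . b . d, then ad(a + Jb) ad(Jd) is idempotent and fixes b, so its trace
   is its rank, which makes B^{1,1} non-degenerate. *)

Require Import Defs.
From HB Require Import structures.
From mathcomp Require Import all_boot all_algebra.
From mathcomp Require Import boolp reals ring.

Set Implicit Arguments.
Unset Strict Implicit.
Unset Printing Implicit Defensive.

Import GRing.Theory Num.Theory passmx.
Local Open Scope ring_scope.

(** * Separating vectors by their coordinates *)

Section VectorSpaces.
Variables (K : fieldType) (V : vectType K).

Lemma vec_ext (x y : V) : (forall f : {additive V -> K}, f x = f y) -> x = y.
Proof.
move=> eqf; rewrite (coord_vbasis (memvf x)) (coord_vbasis (memvf y)).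
by apply: eq_bigr => i _; rewrite (eqf (coord (vbasis fullv) i)).
Qed.

End VectorSpaces.

(* Equations between Z-linear combinations of vectors are checked on coordinates,
   where [ring] applies. *)
Ltac vring :=
  apply: vec_ext => ?; rewrite ?(raddfD, raddfN, raddfB, raddf0) /=; ring.

(** * Bracket identities, [ad] and centralizers *)

Section LieAlgebra.
Variables (K : fieldType) (V : vectType K) (br : V -> V -> V).
Hypothesis lieP : is_lie_bracket br.
Implicit Types (U W : {vspace V}).

Lemma brDl x y z : br (x + y) z = br x z + br y z.
Proof. by have := lie_linearl lieP z 1 x y; rewrite !scale1r. Qed.

Lemma brDr x y z : br x (y + z) = br x y + br x z.
Proof. by have := lie_linearr lieP x 1 y z; rewrite !scale1r. Qed.

Lemma br0r x : br x 0 = 0.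
Proof. by have := brDr x 0 0; rewrite addr0 -[LHS]addr0 => /addrI <-. Qed.

Lemma brNr x y : br x (- y) = - br x y.
Proof. by apply/eqP; rewrite -addr_eq0 -brDr addNr br0r. Qed.

Lemma brNl x y : br (- x) y = - br x y.
Proof. by rewrite (lie_anti lieP) brNr -(lie_anti lieP). Qed.

Lemma brZr k x y : br x (k *: y) = k *: br x y.
Proof. by have := lie_linearr lieP x k y 0; rewrite !addr0 br0r addr0. Qed.

Lemma br_jacobi x y z : br x (br y z) = br (br x y) z + br y (br x z).
Proof.
have := lie_jacobi lieP x y z; rewrite (lie_anti lieP z x) brNr.
rewrite (lie_anti lieP z (br x y)) => /eqP.
by rewrite -addrA -opprD subr_eq0 addrC => /eqP.
Qed.

Lemma ad_E x y : ad br x y = br x y.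
Proof.
pose f : {linear V -> V} := HB.pack (br x)
  (GRing.isSemilinear.Build _ _ _ _ _
     (GRing.semilinear_linear (lie_linearr lieP x))).
by rewrite -[ad br x y]/(linfun f y) lfunE.
Qed.

Lemma mem_brv U W u w : u \in U -> w \in W -> br u w \in brv br U W.
Proof. exact: (brv_subP lieP U W _ (subvv _)). Qed.

Lemma mem_derived x y : br x y \in derived br.
Proof. by rewrite mem_brv ?memvf. Qed.

(** As a finite intersection of kernels over a basis of [U] this is a subspace by construction;
    [centralizerP] removes the basis. *)
Definition centralizer U : {vspace V} :=
  (\bigcap_(i < \dim U) lker (ad br (vbasis U)`_i))%VS.

Lemma centralizerP U x :
  reflect (forall u, u \in U -> br u x = 0) (x \in centralizer U).
Proof.
apply: (iffP idP) => [Cx u Uu | Cx].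
  rewrite (lie_anti lieP) -ad_E; apply/eqP; rewrite oppr_eq0 -memv_ker.
  suff /subvP -> : (U <= lker (ad br x))%VS by [].
  rewrite -[U in (U <= _)%VS](span_basis (vbasisP U)); apply/span_subvP => v.
  case/(nthP 0) => i; rewrite size_tuple => lt_i <-.
  rewrite memv_ker ad_E (lie_anti lieP) oppr_eq0 -ad_E -memv_ker.
  by move: Cx; rewrite memvE => /subv_bigcapP/(_ (Ordinal lt_i) isT).
rewrite memvE; apply/subv_bigcapP => i _; rewrite -memvE memv_ker ad_E Cx //.
by rewrite vbasis_mem // mem_nth ?size_tuple.
Qed.

End LieAlgebra.

(** * Sums of two abelian subalgebras *)

Section Ito.
Variables (K : fieldType) (V : vectType K) (br : V -> V -> V).

(* Ito's argument: in a sum of two abelian subalgebras P and Q the brackets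
   [a, x] and [b, y], with a, b in P and x, y in Q, commute. *)
Lemma ito_commute (brDl : forall x y z, br (x + y) z = br x z + br y z)
    (brDr : forall x y z, br x (y + z) = br x y + br x z)
    (brC : forall x y, br x y = - br y x)
    (brJ : forall x y z, br x (br y z) = br (br x y) z + br y (br x z))
    (P Q : V -> Prop) (PP : forall x y, P x -> P y -> br x y = 0)
    (QQ : forall x y, Q x -> Q y -> br x y = 0)
    (a b x y a1 b2 x1 y2 : V) :
    P a -> P b -> P a1 -> P b2 -> Q x -> Q y -> Q x1 -> Q y2 ->
    br a y = a1 + x1 -> br b x = b2 + y2 ->
  br (br a x) (br b y) = 0.
Proof.
move=> Pa Pb Pa1 Pb2 Qx Qy Qx1 Qy2 Eay Ebx.
have br0 z : br z 0 = 0.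
  by have := brDr z 0 0; rewrite addr0 -[LHS]addr0 => /addrI <-.
have brNl z t : br (- z) t = - br z t.
  by apply/eqP; rewrite -addr_eq0 -brDl addNr brC br0 oppr0.
have swap c u v : Q u -> Q v -> br (br c u) v = br (br c v) u.
  move=> Qu Qv; rewrite [RHS]brC; apply/eqP.
  by rewrite -addr_eq0 -brJ (QQ u v) ?br0.
have E1 c : P c -> br b (br c x) = br c y2.
  by move=> Pc; rewrite brJ (PP b c) // brC br0 oppr0 add0r Ebx brDr (PP c b2) ?add0r.
have E2 z : Q z -> br (br a z) y = br a1 z.
  by move=> Qz; rewrite swap // Eay brDl (QQ x1) ?addr0.
(* The Jacobi identity leaves -[[b, [a, x]], y] and [b, [[a, x], y]], which reduce to -[a1, y2] and
   [a1, y2]. *)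
by rewrite brJ (brC _ b) E1 // brNl !E2 // E1 // addNr.
Qed.
End Ito.

(** * Commutativity of the derived algebra *)

Section AbelianComplexStructure.
Variables (K : fieldType) (V : vectType K) (br : V -> V -> V) (J : 'End(V)).
Hypothesis lieP : is_lie_bracket br.
Hypothesis abJ : is_abelian_complex_structure br J.
Hypothesis two_neq0 : 2%:R != 0 :> K.

Lemma JJ x : J (J x) = - x. Proof. exact: (cplx_sqr abJ.1). Qed.

Lemma brJJ x y : br (J x) (J y) = br x y. Proof. exact: abJ.2. Qed.

Lemma brJr x y : br x (J y) = - br (J x) y.
Proof. by rewrite -brJJ JJ (brNr lieP). Qed.

Lemma brJl x y : br (J x) y = - br x (J y).
Proof. by rewrite brJr opprK. Qed.

(* [V * V] is the complexification of [V], the pair [(x, y)] standing for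
   [x + iy]; the eigenspaces of [J] in it are abelian subalgebras. *)
Let cbr (p q : V * V) : V * V :=
  (br p.1 q.1 - br p.2 q.2, br p.1 q.2 + br p.2 q.1).

(** The complexification is the sum of the two eigenspaces of [J], so [ito_commute] applies to
    brackets between them; real parts bring its conclusion back to [V]. *)
Lemma derived_abelian : {in derived br &, forall x y, br x y = 0}.
Proof.
have E x y z w : cbr (cbr (x, - J x) (y, J y)) (cbr (z, - J z) (w, J w)) = 0.
  have half (t : V) : 2%:R^-1 *: (t + t) = t.
    by rewrite -mulr2n -scaler_nat scalerA mulVf ?scale1r.
  (* [P] and [Q] are the eigenspaces for i and -i; [pP] and [pQ] are the projections onto them. *)
  pose P (p : V * V) := p.2 = - J p.1.
  pose Q (p : V * V) := p.2 = J p.1.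
  pose pP (p : V * V) := (2%:R^-1 *: (p.1 + J p.2), - J (2%:R^-1 *: (p.1 + J p.2))).
  pose pQ (p : V * V) := (2%:R^-1 *: (p.1 - J p.2), J (2%:R^-1 *: (p.1 - J p.2))).
  have pPQ p : p = pP p + pQ p.
    case: p => u v; rewrite /pP /pQ; congr (_, _) => /=.
      by rewrite -scalerDr -[LHS]half; congr (_ *: _); vring.
    rewrite addrC -linearB -scalerBr /=.
    transitivity (J (- J v)); first by rewrite linearN /= JJ opprK.
    congr (fun_of_lfun J _).
    by rewrite -[LHS]half; congr (_ *: _); vring.
  apply: (@ito_commute _ _ cbr _ _ _ _ P Q _ _ _ _ _ _
    (pP (cbr (x, - J x) (w, J w))) (pP (cbr (z, - J z) (y, J y)))
    (pQ (cbr (x, - J x) (w, J w))) (pQ (cbr (z, - J z) (y, J y))));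
    rewrite /P /Q //=.
  - move=> p q r; rewrite /cbr; congr (_, _) => /=; rewrite !(brDl lieP);
    vring.
  - move=> p q r; rewrite /cbr; congr (_, _) => /=; rewrite !(brDr lieP);
    vring.
  - move=> p q; rewrite /cbr; congr (_, _) => /=.
      by rewrite (lie_anti lieP p.1) (lie_anti lieP p.2); vring.
    by rewrite (lie_anti lieP p.1) (lie_anti lieP p.2); vring.
  - move=> p q r; rewrite /cbr; congr (_, _) => /=;
    rewrite !(brDr lieP, brDl lieP, brNr lieP, brNl lieP).
    rewrite !(br_jacobi lieP p.1) !(br_jacobi lieP p.2); vring.
    rewrite !(br_jacobi lieP p.1) !(br_jacobi lieP p.2); vring.
  - move=> p q Pp Qp; rewrite /cbr Pp Qp; congr (_, _).
      by rewrite !(brNr lieP) !(brNl lieP) opprK brJJ subrr.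
    by rewrite (brNr lieP) (brNl lieP) brJr opprK subrr.
  - move=> p q Pp Qp; rewrite /cbr Pp Qp; congr (_, _).
      by rewrite brJJ subrr.
    by rewrite brJr addNr.
have dbl0 (t : V) : t + t = 0 -> t = 0.
  move/eqP; rewrite -mulr2n -scaler_nat scaler_eq0 (negPf two_neq0).
  by move/eqP.
(* The real part of [E] is four times the difference of the two sides, hence two halvings. *)
have G x y z w : br (br x y) (br z w) = br (br x (J y)) (br z (J w)).
  have := E x y z w; rewrite /cbr /= !(brNl lieP, opprK) !brJJ => -[+ _].
  rewrite !brJl !opprK !(brDl lieP, brDr lieP) => E0.
  by apply/eqP; rewrite -subr_eq0; apply/eqP; apply/dbl0/dbl0; rewrite -[RHS]E0; vring.
(* Since [z, Jw] is symmetric in z and w, [G] makes the left side symmetric in z and w; it is also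
   antisymmetric. *)
have F x y z w : br (br x y) (br z w) = 0.
  apply: dbl0; rewrite {1}G [br z (J w)]brJr -(lie_anti lieP w) -G -(brDr lieP).
  by rewrite [br w z](lie_anti lieP) addNr (br0r lieP).
have subD x y : (derived br <= lker (ad br (br x y)))%VS.
  by apply/(brv_subP lieP) => z w _ _; rewrite memv_ker ad_E // F.
suff /subvP sub : (derived br <= centralizer br (derived br))%VS.
  by move=> x y Dx /sub/(centralizerP lieP); apply.
apply/(brv_subP lieP) => x y _ _; apply/(centralizerP lieP) => z.
by move/(subvP (subD x y)); rewrite memv_ker ad_E // (lie_anti lieP) oppr_eq0 => /eqP.
Qed.
End AbelianComplexStructure.

(** The working form of J-semisimplicity, free of derived series; [J_semisimpleP] proves the
    equivalence. *)
Definition no_abelian_J_ideal (K : fieldType) (V : vectType K)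
    (br : V -> V -> V) (J : 'End(V)) :=
  forall W, is_J_ideal br J W -> {in W &, forall x y, br x y = 0} -> W = 0%VS.

(** * J-invariant ideals and J-solvability *)

Section JIdeals.
Variables (K : fieldType) (V : vectType K) (br : V -> V -> V) (J : 'End(V)).
Hypothesis lieP : is_lie_bracket br.
Hypothesis abJ : is_abelian_complex_structure br J.
Implicit Types (U W I : {vspace V}).

Lemma J_invariantP U : J_invariant J U <-> forall x, x \in U -> J x \in U.
Proof.
split=> [JU x Ux | JU]; first exact/(subvP JU)/memv_img.
by apply/subvP => _ /memv_imgP[x Ux ->]; apply: JU.
Qed.

Lemma ideal_subalgebra U : is_ideal br U -> is_subalgebra br U.
Proof. by move=> idU x y _; apply: idU. Qed.

Lemma mem_ideall U x y : is_ideal br U -> x \in U -> br x y \in U.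
Proof. by move=> idU Ux; rewrite (lie_anti lieP) rpredN idU. Qed.

Lemma derived_ideal : is_ideal br (derived br).
Proof. by move=> x y _; apply: mem_derived. Qed.

Lemma ideal_cap U W : is_ideal br U -> is_ideal br W -> is_ideal br (U :&: W)%VS.
Proof.
by move=> idU idW x y /memv_capP[Uy Wy]; rewrite memv_cap idU ?idW.
Qed.

Lemma J_ideal_cap U W :
  is_J_ideal br J U -> is_J_ideal br J W -> is_J_ideal br J (U :&: W)%VS.
Proof.
move=> [idU /J_invariantP JU] [idW /J_invariantP JW].
split; first exact: ideal_cap.
by apply/J_invariantP => x /memv_capP[Ux Wx]; rewrite memv_cap JU ?JW.
Qed.

Lemma J_ideal_fullv : is_J_ideal br J fullv.
Proof. by split; [move=> *; apply: memvf | apply: subvf]. Qed.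

(** As [x, Jb] = -[Jx, b], brackets with JI fall back into I. *)
Lemma J_ideal_addJ I : is_ideal br I -> is_J_ideal br J (I + J @: I)%VS.
Proof.
move=> idI; split=> [x _ /memv_addP[a Ia [_ /memv_imgP[b Ib ->] ->]]|].
  rewrite (brDr lieP) (brJr lieP abJ) memvD ?rpredN //;
  by rewrite (subvP (addvSl _ _)) ?idI.
apply/J_invariantP => _ /memv_addP[a Ia [_ /memv_imgP[b Ib ->] ->]].
by rewrite linearD /= (JJ abJ) addrC memv_add ?rpredN ?memv_img.
Qed.

Lemma brv_ideal U W :
  is_ideal br U -> is_ideal br W -> is_ideal br (brv br U W).
Proof.
move=> idU idW x y; suff /subvP sub : (brv br U W <= ad br x @^-1: brv br U W)%VS.
  by move/sub; rewrite -memv_preim ad_E.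
apply/(brv_subP lieP) => u w Uu Ww; rewrite -memv_preim ad_E // (br_jacobi lieP).
by rewrite memvD ?(mem_brv lieP) ?idU ?idW.
Qed.

Lemma J_ideal_centralizer U :
  is_J_ideal br J U -> is_J_ideal br J (centralizer br U).
Proof.
move=> [idU /J_invariantP JU]; split=> [x y /(centralizerP lieP) Cy | ].
  apply/(centralizerP lieP) => u Uu; rewrite (br_jacobi lieP) !Cy ?(br0r lieP) ?addr0 //.
  exact: mem_ideall.
apply/J_invariantP => y /(centralizerP lieP) Cy; apply/(centralizerP lieP) => u Uu.
by rewrite (brJr lieP abJ) Cy ?oppr0 ?JU.
Qed.

Lemma sub_abelian_J U : is_J_ideal br J U ->
  is_abelian_complex_structure (sub_br br (U := U)) (sub_J J U).
Proof.
move=> [idU JU]; have sU := ideal_subalgebra idU.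
split; first exact: sub_J_complex abJ.1.
by move=> x y; apply: val_inj; rewrite /= !sub_brE // !sub_JE // (brJJ abJ).
Qed.

Lemma quot_abelian_J U : is_J_ideal br J U ->
  is_abelian_complex_structure (quot_br br (U := U)) (quot_J J U).
Proof.
move=> [idU JU]; split; first exact: quot_J_complex abJ.1.
move=> x y; rewrite -[x]vreprK -[y]vreprK.
by rewrite !(quot_JE JU (vrepr _)) !quot_brE // (brJJ abJ).
Qed.

Lemma abelian_J_solvable U : is_J_ideal br J U ->
  {in U &, forall x y, br x y = 0} -> is_J_solvable (sub_br br (U := U)) (sub_J J U).
Proof.
move=> [idU JU] abU; have sU := ideal_subalgebra idU; exists 1%N => /=.
suff -> : brv (sub_br br (U := U)) fullv fullv = 0%VS by rewrite limg0 addv0.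
apply/eqP; rewrite -subv0; apply/(brv_subP (sub_br_lie lieP sU)) => x y _ _.
by rewrite memv0; apply/eqP/val_inj; rewrite /= sub_brE // abU ?subvsP.
Qed.

(* The J-derived series of a J-ideal consists of J-ideals, the last non-zero
   one being abelian. *)
Lemma J_semisimpleP : is_J_semisimple br J <-> no_abelian_J_ideal br J.
Proof.
split=> [ssJ W JW abW | noab U [JidU [j solU]]].
  by apply: ssJ; split=> //; apply: abelian_J_solvable.
have [idU JU] := JidU; have sU := ideal_subalgebra idU.
(* The series of [U] is formed inside [V], so that its terms are ideals of the whole algebra; the
   last clause of [DU] compares it with the series intrinsic to [U]. *)
pose D W := (brv br W W + J @: brv br W W)%VS.
have DU n : [/\ is_J_ideal br J (iter n D U), (iter n D U <= U)%VS
    & forall t, t \in iter n D U ->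
        vsproj U t \in J_derived_series (sub_br br (U := U)) (sub_J J U) n].
  elim: n => [|n [idT TU IH]] /=; first by split=> // t _; apply: memvf.
  set T := iter n D U in idT TU IH *; set S := J_derived_series _ _ n in IH.
  have TT : (brv br T T <= T)%VS.
    by apply/(brv_subP lieP) => x y _; apply: idT.1.
  split; first exact/J_ideal_addJ/brv_ideal/idT.1/idT.1.
    rewrite (subv_trans _ TU) // subv_add TT /=.
    exact: subv_trans (limgS _ TT) idT.2.
  have brT t : t \in brv br T T -> vsproj U t \in brv (sub_br br (U := U)) S S.
    suff /subvP sub : (brv br T T <= linfun (vsproj U) @^-1: brv (sub_br br (U := U)) S S)%VS.
      by move/sub; rewrite -memv_preim lfunE.
    apply/(brv_subP lieP) => u w Tu Tw; rewrite -memv_preim lfunE /=.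
    have -> : vsproj U (br u w) = sub_br br (vsproj U u) (vsproj U w).
      by rewrite /sub_br !vsprojK ?(subvP TU).
    by rewrite mem_brv ?IH //; apply: sub_br_lie.
  move=> _ /memv_addP[a Ta [_ /memv_imgP[b Tb ->] ->]].
  rewrite linearD /= memv_add ?brT //.
  have -> : vsproj U (J b) = sub_J J U (vsproj U b).
    by rewrite lfunE /= vsprojK // (subvP (subv_trans TT TU)).
  by rewrite memv_img ?brT.
have Dj0 : iter j D U = 0%VS.
  have [_ sub inj] := DU j; apply/eqP; rewrite -subv0; apply/subvP => t Tt.
  have /eqP t0 : vsproj U t == 0 by rewrite -memv0 -solU inj.
  by rewrite -(vsprojK (subvP sub _ Tt)) t0 linear0 mem0v.
(* A term whose successor is zero is an abelian J-ideal, hence zero; this descends to the term of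
   index 0, which is [U]. *)
elim: j Dj0 {solU} => // j IH /= Dj0; apply/IH/noab; first by case: (DU j).
move=> x y Tx Ty; apply/eqP; rewrite -memv0 -Dj0 /D.
by rewrite (subvP (addvSl _ _)) ?(mem_brv lieP).
Qed.

End JIdeals.

(** * The derived algebra as a commutative associative algebra *)

Section DerivedAlgebra.
Variables (K : fieldType) (V : vectType K) (br : V -> V -> V) (J : 'End(V)).
Hypothesis lieP : is_lie_bracket br.
Hypothesis abJ : is_abelian_complex_structure br J.
Hypothesis two_neq0 : 2%:R != 0 :> K.
Implicit Types (U W I S : {vspace V}).

Local Notation A := (derived br).
Let abA := derived_abelian lieP abJ two_neq0.

Lemma brJ_sym a b : br (J a) b = br (J b) a.
Proof. by rewrite (brJl lieP abJ) -(lie_anti lieP). Qed.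

(** The Jacobi error term [[x, Ja], b] is a bracket inside A, so it vanishes. For x = Jc this is
    associativity of a . b = [Ja, b], given the commutativity in [brJ_sym]. *)
Lemma br_mulr x a b : b \in A -> br x (br (J a) b) = br (J a) (br x b).
Proof.
by move=> Ab; rewrite (br_jacobi lieP) abA ?add0r ?(mem_derived lieP).
Qed.

Lemma br_mull x a b : a \in A -> br x (br (J a) b) = br (J (br x a)) b.
Proof. by move=> Aa; rewrite brJ_sym br_mulr // brJ_sym. Qed.

Definition annihilator S : {vspace V} := (A :&: centralizer br (J @: S))%VS.

Lemma annihilatorP S x :
  reflect (x \in A /\ forall s, s \in S -> br (J s) x = 0) (x \in annihilator S).
Proof.
apply: (iffP memv_capP) => -[Ax Cx]; split=> //.
  by move=> s Ss; apply: (centralizerP lieP _ _ Cx); apply: memv_img.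
by apply/(centralizerP lieP) => _ /memv_imgP[s Ss ->]; apply: Cx.
Qed.

Lemma annihilator_ideal S : is_ideal br (annihilator S).
Proof.
move=> x y /annihilatorP[Ay Cy]; apply/annihilatorP.
split=> [|s Ss]; first exact: mem_derived.
by rewrite -br_mulr // Cy // (br0r lieP).
Qed.

Hypothesis noab : no_abelian_J_ideal br J.

(** Let N be the annihilator of a. If a . a = 0, then a lies in the intersection I of N with its own
    annihilator. This I is an ideal with I . I = 0, so I + JI is an abelian J-ideal. *)
Lemma derived_reduced a : a \in A -> br (J a) a = 0 -> a = 0.
Proof.
move=> Aa aa0; pose N := annihilator <[a]>; pose I := (N :&: annihilator N)%VS.
have idI : is_ideal br I by apply: ideal_cap; apply: annihilator_ideal.
have mulI i j : i \in I -> j \in I -> br (J i) j = 0.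
  by move=> /memv_capP[Ni _] /memv_capP[_ /annihilatorP[_]]; apply.
have IA : (I <= A)%VS by apply: subv_trans (capvSl _ _) (capvSl _ _).
have Ia : a \in I.
  apply/memv_capP; split; apply/annihilatorP; split=> // s.
    by case/vlineP=> k ->; rewrite brJ_sym (brZr lieP) aa0 scaler0.
  by case/annihilatorP=> _ /(_ a (memv_line a)); rewrite brJ_sym.
suff I0 : (I + J @: I)%VS = 0%VS.
  by apply/eqP; rewrite -memv0 -I0 (subvP (addvSl _ _)).
apply: noab; first exact: (J_ideal_addJ lieP abJ).
move=> ? ? /memv_addP[i Ii [_ /memv_imgP[i' Ii' ->] ->]].
move=> /memv_addP[j Ij [_ /memv_imgP[j' Ij' ->] ->]].
rewrite !(brDl lieP, brDr lieP) (brJJ abJ) (lie_anti lieP i (J j')) !mulI //.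
by rewrite !abA ?(subvP IA) // oppr0 !addr0.
Qed.

(** Let L be multiplication by a. Reducedness gives L and L^2 the same kernel on A, hence, by
    dimension, the same image. *)
Lemma derived_regular a :
  a \in A -> exists2 x, x \in A & br (J a) (br (J a) x) = a.
Proof.
move=> Aa; pose L := ad br (J a).
have LE x : L x = br (J a) x by rewrite /L ad_E.
have nil x y : x \in A -> y \in A -> br (J a) y = 0 -> br (J (br (J a) x)) y = 0.
  by move=> Ax Ay ay0; rewrite -br_mull // br_mulr // ay0 (br0r lieP).
have kerL : (A :&: lker (L \o L) = A :&: lker L)%VS.
  apply/eqP; rewrite eqEsubv !subv_cap !capvSl /=; apply/andP; split.
    apply/subvP => x /memv_capP[Ax]; rewrite !memv_ker comp_lfunE !LE => /eqP aax0.
    apply/eqP/derived_reduced; first exact: mem_derived.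
    by apply: nil => //; apply: mem_derived.
  apply/subvP => x /memv_capP[_]; rewrite !memv_ker comp_lfunE => /eqP ->.
  by rewrite linear0.
have imL : (L @: A = (L \o L) @: A)%VS.
  apply/esym/eqP; rewrite eqEdim limg_comp; apply/andP; split.
    by apply: limgS; apply/subvP => _ /memv_imgP[x _ ->]; rewrite LE mem_derived.
  rewrite -limg_comp -(leq_add2l (\dim (A :&: lker L))) -{2}kerL.
  by rewrite !limg_ker_dim.
have [x Ax aax] : exists2 x, x \in A & L a = L (L x).
  have: L a \in (L @: A)%VS by apply: memv_img.
  by rewrite imL => /memv_imgP[x Ax]; rewrite comp_lfunE; exists x.
(* A unit of A is not yet available, so a in L(A) needs an argument: d = a - a . x satisfies a . d =
   0, whence d . d = 0. *)
have d0 : a - L x = 0.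
  have Ad : a - L x \in A by rewrite memvB // LE mem_derived.
  have ad0 : br (J a) (a - L x) = 0 by rewrite -LE linearB /= aax subrr.
  apply: derived_reduced => //; rewrite linearB /= (brDl lieP) (brNl lieP) ad0.
  by rewrite LE in Ad ad0 *; rewrite nil // oppr0 addr0.
have: L x \in (L @: A)%VS by apply: memv_img.
rewrite imL => /memv_imgP[y Ay]; rewrite comp_lfunE !LE => E.
by exists y => //; rewrite -E -LE; apply/esym/eqP; rewrite -subr_eq0 d0.
Qed.

(** The unit is built along a basis of I, enlarging e at each step so that it fixes one more basis
    vector. *)
Lemma derived_ideal_unit I : is_ideal br I -> (I <= A)%VS ->
  exists2 e, e \in I & forall i, i \in I -> br (J e) i = i.
Proof.
move=> idI /subvP IA.
suff [e Ie eP] : exists2 e, e \in I & forall i, i \in tval (vbasis I) -> br (J e) i = i.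
  exists e => // i Ii; apply/eqP; rewrite -subr_eq0.
  have <- : (ad br (J e) - \1)%VF i = br (J e) i - i.
    by rewrite add_lfunE opp_lfunE id_lfunE ad_E.
  rewrite -memv_ker.
  suff /subvP -> : (I <= lker (ad br (J e) - \1)%VF)%VS by [].
  rewrite -[I in (I <= _)%VS](span_basis (vbasisP I)); apply/span_subvP => v Iv.
  by rewrite memv_ker add_lfunE opp_lfunE id_lfunE ad_E // eP // subrr.
have: {subset tval (vbasis I) <= I} by move=> v; apply: vbasis_mem.
elim: (tval (vbasis I)) => [_|a s IH sI]; first by exists 0; rewrite ?mem0v.
have [|e Ie eP] := IH; first by move=> v sv; apply: sI; rewrite inE sv orbT.
have Ia : a \in I by apply: sI; rewrite mem_head.
pose b := a - br (J e) a; have Ib : b \in I by rewrite memvB ?idI //.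
have [x Ax bbx] := derived_regular (IA b Ib); pose f := br (J b) x.
have If : f \in I by rewrite /f brJ_sym idI.
(* The usual join of e and f: it sends w to e . w + f . (w - e . w). It keeps what e fixes and also
   fixes a, since f = b . x fixes the defect b = a - e . a. *)
exists (e + f - br (J f) e); first exact: memvB (memvD Ie If) (idI _ _ Ie).
have mulE w : br (J (e + f - br (J f) e)) w
    = br (J e) w + br (J f) (w - br (J e) w).
  rewrite !linearB !linearD /= !(brDl lieP, brNl lieP) -(br_mull _ _ (IA e Ie)).
  by rewrite (brDr lieP) (brNr lieP) addrA.
move=> w; rewrite inE mulE => /predU1P[->|sw].
  by rewrite -/b [br (J f) b]brJ_sym bbx addrC subrK.
by rewrite eP // subrr (br0r lieP) addr0.
Qed.

(** For the unit e of I, the element v = J[x, e] + [Jx, e] acts on I + JI as x does, so x - v lies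
    in C. Brackets in U :&: C lie in I, where ad(Je) is the identity, and also in C, which Je
    centralizes; so U :&: C is abelian. *)
Lemma J_ideal_decomposition U (I := (U :&: A)%VS)
    (C := centralizer br (I + J @: I)%VS) :
  is_J_ideal br J U -> (I + J @: I + C)%VS = fullv /\ (U :&: C)%VS = 0%VS.
Proof.
move=> JidU; have [idU JU] := JidU.
have idI : is_ideal br I by apply: ideal_cap => //; apply: derived_ideal.
have JidC : is_J_ideal br J C by apply/J_ideal_centralizer/J_ideal_addJ.
have IA : (I <= A)%VS by apply: capvSr.
have [e Ie eP] := derived_ideal_unit idI IA.
split.
  apply/eqP; rewrite eqEsubv subvf; apply/subvP => x _.
  pose v := J (br x e) + br (J x) e.
  have Vv : v \in (I + J @: I)%VS by rewrite /v addrC memv_add ?memv_img ?idI.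
  rewrite -(subrK v x) addrC memv_add //.
  have brI z y : z \in I -> br y z = br (J (br y e)) z.
    by move=> Iz; rewrite -{1}(eP z Iz) br_mull // (subvP IA).
  have abI y z : z \in I -> br (br y e) z = 0.
    by move=> Iz; rewrite abA ?(mem_derived lieP) ?(subvP IA).
  have wI z : z \in I -> br (x - v) z = 0.
    move=> Iz; rewrite (brDl lieP) (brNl lieP) (brDl lieP) -(brI z x Iz).
    by rewrite abI // addr0 subrr.
  have JwI z : z \in I -> br (J (x - v)) z = 0.
    move=> Iz; have -> : J (x - v) = J x - J (br (J x) e) + br x e.
      by rewrite linearB /= linearD /= (JJ abJ); vring.
    rewrite (brDl lieP) abI // addr0 (brDl lieP) (brNl lieP).
    by rewrite -(brI z (J x) Iz) subrr.
  apply/(centralizerP lieP) => _ /memv_addP[i Ii [_ /memv_imgP[j Ij ->] ->]].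
  by rewrite (lie_anti lieP) (brDr lieP) (brJr lieP abJ) wI ?JwI // oppr0 addr0 oppr0.
apply: noab; first exact: J_ideal_cap.
move=> c d /memv_capP[Uc Cc] /memv_capP[Ud Cd].
have Icd : br c d \in I by rewrite memv_cap idU // mem_derived.
rewrite -(eP _ Icd); apply: (centralizerP lieP _ _ _ (J e)); first exact: JidC.1.
by rewrite (subvP (addvSr _ _)) // memv_img.
Qed.

Lemma J_ideal_complement U : is_J_ideal br J U ->
  exists C, [/\ is_J_ideal br J C, (U + C)%VS = fullv & (U :&: C)%VS = 0%VS].
Proof.
move=> JidU; have [full disj] := J_ideal_decomposition JidU.
have idI : is_ideal br (U :&: A)%VS.
  by apply: ideal_cap JidU.1 _; apply: derived_ideal.
eexists; split; last exact: disj.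
  by apply: J_ideal_centralizer => //; apply: J_ideal_addJ.
apply/eqP; rewrite eqEsubv subvf -full addvS // subv_add capvSl /=.
exact: subv_trans (limgS _ (capvSl _ _)) JidU.2.
Qed.

(** If x = Jy with x and y in A, then x . x = -[y, x] = 0. *)
Lemma derived_capJ : (A :&: J @: A)%VS = 0%VS.
Proof.
apply/eqP; rewrite -subv0; apply/subvP => x /memv_capP[Ax /memv_imgP[y Ay xE]].
rewrite memv0; apply/eqP/derived_reduced => //.
by rewrite {1}xE (JJ abJ) (brNl lieP) abA ?oppr0.
Qed.

Lemma derived_addJ : (A + J @: A)%VS = fullv.
Proof.
have [] := J_ideal_decomposition (J_ideal_fullv br J).
by rewrite !capfv => full C0; rewrite C0 addv0 in full.
Qed.

Lemma semidirect_derived : is_semidirect br A (J @: A)%VS.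
Proof.
split; [exact: derived_ideal| |exact: derived_addJ|exact/directv_addP/derived_capJ].
move=> ? ? /memv_imgP[x Ax ->] /memv_imgP[y Ay ->].
by rewrite (brJJ abJ) abA // mem0v.
Qed.

(** A complementary J-ideal commutes with [U], so stability under brackets with [U] suffices. *)
Lemma J_ideal_of_sub U (W : {vspace subvs_of U}) : is_J_ideal br J U ->
  is_J_ideal (sub_br br (U := U)) (sub_J J U) W ->
  is_J_ideal br J (linfun vsval @: W)%VS.
Proof.
move=> JidU [idW /J_invariantP JW]; have [idU JU] := JidU.
have sU := ideal_subalgebra idU.
have [C [[idC _] full disj]] := J_ideal_complement JidU.
split=> [x _ /memv_imgP[w Ww ->]|].
  have /memv_addP[u Uu [c Cc ->]] : x \in (U + C)%VS by rewrite full memvf.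
  have cw0 : br c (vsval w) = 0.
    apply/eqP; rewrite -memv0 -disj memv_cap idU ?subvsP //=.
    exact: (mem_ideall lieP).
  rewrite lfunE (brDl lieP) /= cw0 addr0.
  have -> : br u (vsval w) = linfun vsval (sub_br br (vsproj U u) w).
    by rewrite lfunE /= sub_brE //= vsprojK.
  by rewrite memv_img ?idW.
apply/J_invariantP => _ /memv_imgP[w Ww ->].
have -> : J (linfun vsval w) = linfun vsval (sub_J J U w).
  by rewrite [RHS]lfunE /= sub_JE // lfunE.
by rewrite memv_img ?JW.
Qed.

Lemma no_abelian_J_ideal_sub U : is_J_ideal br J U ->
  no_abelian_J_ideal (sub_br br (U := U)) (sub_J J U).
Proof.
move=> JidU W JidW abW; have [idU JU] := JidU; have sU := ideal_subalgebra idU.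
have := noab (J_ideal_of_sub JidU JidW) => /(_ _)/eqP W0.
apply/eqP; rewrite -subv0; apply/subvP => w Ww; rewrite memv0; apply/eqP/val_inj.
have: linfun vsval w \in (linfun vsval @: W)%VS by apply: memv_img.
rewrite (eqP (W0 _)) ?memv0 ?lfunE => [/eqP //|].
move=> ? ? /memv_imgP[x Wx ->] /memv_imgP[y Wy ->].
by rewrite !lfunE /= -sub_brE // abW // linear0.
Qed.

(** Let C be a J-ideal complementary to U and P the preimage of W. Brackets in P :&: C lie in U and
    in C, so P :&: C is abelian, hence zero; but every coset in W has a representative there. *)
Lemma no_abelian_J_ideal_quot U : is_J_ideal br J U ->
  no_abelian_J_ideal (quot_br br (U := U)) (quot_J J U).
Proof.
move=> JidU W [idW /J_invariantP JW] abW; have [idU JU] := JidU.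
have [C [JidC full disj]] := J_ideal_complement JidU.
pose P := (linfun (vpi U) @^-1: W)%VS.
have PE x : (x \in P) = (vpi U x \in W) by rewrite -memv_preim lfunE.
have JidP : is_J_ideal br J P.
  split=> [x y|]; first by rewrite !PE -quot_brE //; apply: idW.
  by apply/J_invariantP => x; rewrite !PE -quot_JE //; apply: JW.
have PC0 : (P :&: C)%VS = 0%VS.
  apply: noab; first exact: J_ideal_cap.
  move=> x y /memv_capP[]; rewrite PE => Wx Cx /memv_capP[]; rewrite PE => Wy Cy.
  apply/eqP; rewrite -memv0 -disj memv_cap JidC.1 // andbT.
  rewrite -[br x y]subr0; apply/vpiP; rewrite -quot_brE // abW //.
  by rewrite linear0.
apply/eqP; rewrite -subv0; apply/subvP => q Wq; rewrite memv0 -[q]vreprK.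
have /memv_addP[u Uu [c Cc E]] : vrepr q \in (U + C)%VS by rewrite full memvf.
have pc : vpi U (vrepr q) = vpi U c by apply/vpiP; rewrite E addrK.
suff: c \in (P :&: C)%VS by rewrite PC0 memv0 pc => /eqP ->; rewrite linear0.
by rewrite memv_cap Cc PE -pc vreprK Wq.
Qed.

End DerivedAlgebra.

(** * Decomposition into J-simple ideals *)

Section JSimpleIdeals.
Variables (K : fieldType) (V : vectType K) (br : V -> V -> V) (J : 'End(V)).
Hypothesis lieP : is_lie_bracket br.
Hypothesis abJ : is_abelian_complex_structure br J.
Implicit Types (U W : {vspace V}).

Lemma J_simple_ideal_nonabelian U : is_J_simple_ideal br J U ->
  ~ {in U &, forall x y, br x y = 0}.
Proof.
move=> [[idU JU] [nab _]] abU; apply: nab => x y; apply: val_inj.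
by rewrite /= sub_brE ?abU ?subvsP //; apply: ideal_subalgebra.
Qed.

Lemma J_simple_ideal_minimal U W : is_J_simple_ideal br J U ->
  is_J_ideal br J W -> (W <= U)%VS -> W = 0%VS \/ W = U.
Proof.
move=> [[idU JU] [_ simU]] [idW /J_invariantP JW] WU.
have sU := ideal_subalgebra idU.
pose W' := (linfun vsval @^-1: W : {vspace subvs_of U})%VS.
have W'E u : (u \in W') = (vsval u \in W) by rewrite -memv_preim lfunE.
have [|W'0|W'f] := simU W'; [split=> [x y|] | left | right].
- by rewrite !W'E sub_brE //; apply: idW.
- by apply/J_invariantP => x; rewrite !W'E sub_JE //; apply: JW.
- apply/eqP; rewrite -subv0; apply/subvP => w Ww.
  have : vsproj U w \in W' by rewrite W'E vsprojK // (subvP WU).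
  rewrite W'0 !memv0 => /eqP w0.
  by rewrite -(vsprojK (subvP WU _ Ww)) w0 linear0.
- apply/eqP; rewrite eqEsubv WU; apply/subvP => u Uu.
  by rewrite -(vsprojK Uu) -W'E W'f memvf.
Qed.

(** An abelian J-ideal W meets every [k i] in 0, hence is central. The components of a central
    element are central, and the centre also meets every [k i] in 0. *)
Lemma sum_J_simple_no_abelian :
  is_sum_of_J_simple_ideals br J -> no_abelian_J_ideal br J.
Proof.
move=> [n [k [simk sumk /directv_sumP dirk]]] W JidW abW.
have Wk i : (W :&: k i = 0)%VS.
  have JidWk := J_ideal_cap JidW (simk i).1.
  have [//|Wk] := J_simple_ideal_minimal (simk i) JidWk (capvSr _ _).
  case: (J_simple_ideal_nonabelian (simk i)) => x y.
  by rewrite -Wk => /memv_capP[Wx _] /memv_capP[Wy _]; apply: abW.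
pose Z := centralizer br fullv.
have JidZ : is_J_ideal br J Z by apply/J_ideal_centralizer/J_ideal_fullv.
have Zk i : (Z :&: k i = 0)%VS.
  have JidZk := J_ideal_cap JidZ (simk i).1.
  have [//|Zk] := J_simple_ideal_minimal (simk i) JidZk (capvSr _ _).
  case: (J_simple_ideal_nonabelian (simk i)) => x y _.
  rewrite -Zk => /memv_capP[/(centralizerP lieP) Zy _].
  by apply: Zy; apply: memvf.
have WZ w x : w \in W -> br x w = 0.
  move=> Ww; rewrite (lie_anti lieP) -ad_E //.
  have /memv_sumP[xs kxs ->] : x \in (\sum_(i < n) k i)%VS by rewrite sumk memvf.
  rewrite linear_sum big1 ?oppr0 //= => i _; apply/eqP.
  rewrite ad_E // -memv0 -(Wk i) memv_cap (mem_ideall lieP _ JidW.1) //=.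
  by rewrite (simk i).1.1 ?kxs.
apply/eqP; rewrite -subv0; apply/subvP => w Ww; rewrite memv0.
have /memv_sumP[ws kws wE] : w \in (\sum_(i < n) k i)%VS by rewrite sumk memvf.
rewrite wE big1 // => i _; apply/eqP; rewrite -memv0 -(Zk i) memv_cap kws // andbT.
apply/(centralizerP lieP) => x _; apply/eqP; rewrite -memv0 -(dirk i isT).
rewrite memv_cap (simk i).1.1 ?kws //=.
(* Centrality of w moves [x, w_i] into the sum of the other [k j]. *)
have -> : br x (ws i) = - \sum_(j < n | j != i) br x (ws j).
  apply/eqP; rewrite -addr_eq0 -(bigD1 i (P := xpredT) (F := fun j => br x (ws j))) //=.
  rewrite (eq_bigr (fun j => ad br x (ws j))) => [|j _]; last by rewrite ad_E.
  by rewrite -linear_sum -wE /= ad_E // WZ.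
by rewrite rpredN memv_sumr // => j _; rewrite (simk j).1.1 ?kws.
Qed.

Hypothesis two_neq0 : 2%:R != 0 :> K.
Hypothesis noab : no_abelian_J_ideal br J.

Lemma minimal_J_simple_ideal U : is_J_ideal br J U -> U <> 0%VS ->
    (forall W, is_J_ideal br J W -> (W <= U)%VS -> W = 0%VS \/ W = U) ->
  is_J_simple_ideal br J U.
Proof.
move=> JidU U0 minU; have [idU JU] := JidU; have sU := ideal_subalgebra idU.
split=> //; split=> [abU | W JidW].
  apply/U0/noab => // x y Ux Uy; rewrite -(vsprojK Ux) -(vsprojK Uy).
  by rewrite -sub_brE // abU linear0.
have mW w : w \in W -> vsval w \in (linfun vsval @: W)%VS.
  by move=> Ww; rewrite -[vsval w]lfunE memv_img.
have JidW' := J_ideal_of_sub lieP abJ two_neq0 noab JidU JidW.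
case: (minU _ JidW') => [|W'0|W'U]; [|left|right].
- by apply/subvP => _ /memv_imgP[w _ ->]; rewrite lfunE subvsP.
- apply/eqP; rewrite -subv0; apply/subvP => w /mW; rewrite W'0 !memv0.
  by move/eqP => w0; apply/eqP/val_inj.
apply/eqP; rewrite eqEsubv subvf; apply/subvP => w _.
have /memv_imgP[w' Ww'] : vsval w \in (linfun vsval @: W)%VS by rewrite W'U subvsP.
by rewrite lfunE => /val_inj ->.
Qed.

(** By induction on dimension, a J-ideal that is not minimal splits off a complement. The equality
    of dimensions encodes that the sum over the list is direct. *)
Lemma J_ideal_sum_J_simple U : is_J_ideal br J U ->
  exists s : seq {vspace V},
    [/\ forall W, W \in s -> is_J_simple_ideal br J W,
        (\sum_(W <- s) W)%VS = U & (\sum_(W <- s) \dim W)%N = \dim U].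
Proof.
have [n] := ubnP (\dim U); elim: n U => // n IH U ltU JidU.
have [->|/eqP U0] := eqVneq U 0%VS.
  by exists [::]; rewrite !big_nil dimv0.
have [[W [JidW WU W0 WnU]]|minU] := pselect (exists W,
    [/\ is_J_ideal br J W, (W <= U)%VS, W <> 0%VS & W <> U]); last first.
  exists [:: U]; rewrite !big_seq1; split=> // W; rewrite inE => /eqP ->.
  apply: minimal_J_simple_ideal => // X JidX XU.
  have [|X0] := eqVneq X 0%VS; first by left.
  have [|XnU] := eqVneq X U; first by right.
  by case: minU; exists X; split=> //; apply/eqP.
have [C [JidC full disj]] := J_ideal_complement lieP abJ two_neq0 noab JidW.
have UE : (W + (U :&: C))%VS = U.
  by rewrite capvC vspace_modl // full capfv.
have disjX : (W :&: (U :&: C))%VS = 0%VS.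
  by apply/eqP; rewrite -subv0 -disj capvS // capvSr.
have dimU : (\dim U = \dim W + \dim (U :&: C))%N by rewrite -{1}UE dimv_disjoint_sum.
have W_gt0 : (0 < \dim W)%N by rewrite lt0n dimv_eq0; apply/eqP.
have X_gt0 : (0 < \dim (U :&: C))%N.
  rewrite lt0n dimv_eq0; apply/eqP => X0.
  by apply: WnU; rewrite -UE X0 addv0.
have [|s [sims sums dims]] := IH W _ JidW.
  by apply: leq_trans (ltU : (\dim U <= n)%N); rewrite dimU -addn1 leq_add2l.
have [|t [simt sumt dimt]] := IH (U :&: C)%VS _ (J_ideal_cap JidU JidC).
  by apply: leq_trans (ltU : (\dim U <= n)%N); rewrite dimU -add1n leq_add2r.
exists (s ++ t); rewrite !big_cat /= sums sumt dims dimt; split=> // X.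
by rewrite mem_cat => /orP[/sims|/simt].
Qed.

Lemma is_sum_of_J_simple : is_sum_of_J_simple_ideals br J.
Proof.
have [s [sims sums dims]] := J_ideal_sum_J_simple (J_ideal_fullv br J).
exists (size s), (fun i => nth 0%VS s i); split.
- by move=> i; apply/sims/mem_nth.
- by rewrite -sums (big_nth 0%VS) big_mkord.
- rewrite directvE /= -[X in \dim X](big_mkord xpredT (nth 0%VS s)).
  rewrite -(big_mkord xpredT (fun i => \dim (nth 0%VS s i))).
  by rewrite -(big_nth 0%VS xpredT id) -(big_nth 0%VS xpredT (fun W => \dim W)) sums dims.
Qed.

End JSimpleIdeals.

(** * Traces of square-zero and idempotent endomorphisms *)

Section Trace.
Variables (K : fieldType).

(** For square M = CR, tr M = tr RC and RC = D M^2 B, so the trace can be read off when M^2 is 0 or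
    M. *)
Lemma rank_factorization m n (M : 'M[K]_(m, n)) :
  exists (C : 'M_(m, \rank M)) (R : 'M_(\rank M, n)) D B,
    [/\ C *m R = M, D *m C = 1%:M & R *m B = 1%:M].
Proof.
have /row_freeP[B RB] := row_base_free M.
have /row_fullP[D DC] := col_base_full M.
by exists (col_base M), (row_base M), D, B; rewrite mulmx_base.
Qed.

Lemma mxtrace_sqr0 n (M : 'M[K]_n) : M *m M = 0 -> \tr M = 0.
Proof.
have [C [R [D [B]]]] := rank_factorization M.
move: (\rank M) C R D B => r C R D B [<- DC RB] MM; rewrite mxtrace_mulC.
have <- : D *m ((C *m R) *m (C *m R)) *m B = R *m C.
  by rewrite !mulmxA DC mul1mx -!mulmxA RB mulmx1.
by rewrite MM mulmx0 mul0mx linear0.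
Qed.

Lemma mxtrace_idem n (M : 'M[K]_n) : M *m M = M -> \tr M = (\rank M)%:R.
Proof.
have [C [R [D [B]]]] := rank_factorization M.
move: (\rank M) C R D B => r C R D B [<- DC RB] MM; rewrite mxtrace_mulC.
have <- : D *m ((C *m R) *m (C *m R)) *m B = R *m C.
  by rewrite !mulmxA DC mul1mx -!mulmxA RB mulmx1.
by rewrite MM mulmxA DC mul1mx RB mxtrace1.
Qed.

Variable V : vectType K.
Implicit Type f : 'End(V).

Lemma lfun_tr_sqr0 f : (forall v, f (f v) = 0) -> lfun_tr f = 0.
Proof.
move=> ff; apply: mxtrace_sqr0; rewrite -mxof_comp ?vbasisP //.
by apply/eqP; rewrite mxof_eq0 ?vbasisP //; apply/eqP/lfunP => v; rewrite comp_lfunE ff lfunE.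
Qed.

Lemma lfun_tr_idem f :
  (forall v, f (f v) = f v) ->
  lfun_tr f = (\rank (mxof (vbasis {:V}) (vbasis {:V}) f))%:R.
Proof.
move=> ff; apply: mxtrace_idem; rewrite -mxof_comp ?vbasisP //.
by congr mxof; apply/lfunP => v; rewrite comp_lfunE ff.
Qed.

End Trace.

(** * The Killing form and the nilradical *)

Section KillingForm.
Variables (K : numFieldType) (V : vectType K) (br : V -> V -> V) (J : 'End(V)).
Hypothesis lieP : is_lie_bracket br.
Hypothesis abJ : is_abelian_complex_structure br J.
Implicit Types (U W : {vspace V}).

Local Notation A := (derived br).
Let two_neq0 : 2%:R != 0 :> K. Proof. by rewrite pnatr_eq0. Qed.
Let abA := derived_abelian lieP abJ two_neq0.

Lemma killing_sqr0 x y :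
  (forall v, br x (br y (br x (br y v))) = 0) -> killing br x y = 0.
Proof.
by move=> xy2; apply: lfun_tr_sqr0 => v; rewrite !comp_lfunE !ad_E.
Qed.

Lemma killing_idem_neq0 x y v :
    (forall w, br x (br y (br x (br y w))) = br x (br y w)) ->
  br x (br y v) != 0 -> killing br x y != 0.
Proof.
move=> idem xyv; rewrite /killing lfun_tr_idem => [|w].
  rewrite pnatr_eq0 mxrank_eq0 mxof_eq0 ?vbasisP //.
  by apply: contraNneq xyv => f0; rewrite -!ad_E // -comp_lfunE f0 lfunE.
by rewrite !comp_lfunE !ad_E.
Qed.

(** For u in an abelian ideal, ad u ad z has square zero; hence an abelian J-ideal lies in the
    radical of B^{1,1}. *)
Lemma nondegenerate_no_abelian :
  nondegenerate_form (killing11 br J) -> no_abelian_J_ideal br J.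
Proof.
move=> ndB W [idW /J_invariantP JW] abW.
apply/eqP; rewrite -subv0; apply/subvP => w Ww; rewrite memv0; apply/eqP/ndB => y.
have killW u z : u \in W -> killing br u z = 0.
  move=> Wu; apply: killing_sqr0 => v.
  by rewrite abW // idW // (mem_ideall lieP _ idW).
by rewrite /killing11 !killW ?JW // addr0 mulr0.
Qed.

Hypothesis noab : no_abelian_J_ideal br J.

Lemma killing_derivedr u d : d \in A -> killing br u d = 0.
Proof.
move=> Ad; apply: killing_sqr0 => v.
by rewrite (abA Ad) ?(br0r lieP) ?(mem_derived lieP).
Qed.

(** On A, a + Jb acts as multiplication by b, and ad(Jd) maps into A. So the product of the two maps
    has image in A and acts there as multiplication by b . d, which fixes b and every b . t. *)
Lemma killing_regular_neq0 a b d : a \in A -> b \in A -> d \in A ->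
  br (J b) (br (J b) d) = b -> b != 0 -> killing br (a + J b) (J d) != 0.
Proof.
move=> Aa Ab Ad bbd b0.
have E t : t \in A -> br (a + J b) t = br (J b) t.
  by move=> At; rewrite (brDl lieP) abA // add0r.
have Ader x y : br x y \in A by apply: mem_derived.
apply: (@killing_idem_neq0 _ _ b) => [w|]; last first.
  by rewrite E // (brJ_sym lieP abJ d) bbd.
rewrite !E //; set t := br (J d) w; have At : t \in A by apply: Ader.
rewrite (br_mulr lieP abJ two_neq0 (J d)) // (br_mull lieP abJ two_neq0 (J b) t Ad).
by rewrite (br_mull lieP abJ two_neq0 (J b) t (Ader _ _)) bbd.
Qed.

Lemma killing11_nondegenerate : nondegenerate_form (killing11 br J).
Proof.
move=> x radx.
have kill0 y : killing br x y + killing br (J x) (J y) = 0.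
  by apply/eqP; have /eqP := radx y; rewrite mulf_eq0 invr_eq0 (negPf two_neq0).
have /memv_addP[a Aa [_ /memv_imgP[b Ab ->] xE]] : x \in (A + J @: A)%VS.
  by rewrite derived_addJ ?memvf.
have b0 : b = 0.
  apply/eqP/negPn/negP => nzb.
  have [d Ad bbd] := derived_regular lieP abJ two_neq0 noab Ab.
  case/negP: (killing_regular_neq0 Aa Ab Ad bbd nzb); rewrite -xE.
  (* Testing against Jd makes the second term B(Jx, -d), which vanishes because d lies in A. *)
  have := kill0 (J d); rewrite [J (J d)](JJ abJ) (killing_derivedr (J x)) ?rpredN //.
  by rewrite addr0 => ->.
have a0 : a = 0.
  apply/eqP/negPn/negP => nza.
  have [d Ad aad] := derived_regular lieP abJ two_neq0 noab Aa.
  case/negP: (killing_regular_neq0 (mem0v _) Aa Ad aad nza).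
  (* Now x = a, and testing against d leaves only B(Ja, Jd). *)
  by have := kill0 d; rewrite killing_derivedr // xE b0 linear0 addr0 !add0r => ->.
by rewrite xE a0 b0 linear0 addr0.
Qed.

(** A is abelian, hence nilpotent. If a + Jb lies in a nilpotent ideal U, it acts on A as
    multiplication by b. With b = b . b . x one gets b . z = b . (b . (x . z)), so b . A lies in
    every term of the lower central series of U. As b is in b . A, it is zero. *)
Lemma nilradical_derived : is_nilradical br A.
Proof.
have idA : is_ideal br A by apply: derived_ideal.
split=> [|U [idU [k nilU]]].
  split=> //; exists 1%N; apply/eqP; rewrite -subv0.
  apply/(brv_subP (sub_br_lie lieP (ideal_subalgebra idA))) => x y _ _.
  rewrite memv0; apply/eqP/val_inj.
  by rewrite /= sub_brE ?abA ?subvsP //; apply: ideal_subalgebra.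
have sU := ideal_subalgebra idU.
apply/subvP => u Uu.
have /memv_addP[a Aa [_ /memv_imgP[b Ab ->] uE]] : u \in (A + J @: A)%VS.
  by rewrite derived_addJ ?memvf.
suff b0 : b = 0 by rewrite uE b0 linear0 addr0.
have Ader x y : br x y \in A by apply: mem_derived.
have [x Ax bbx] := derived_regular lieP abJ two_neq0 noab Ab.
have bE z : z \in A -> br (J b) z = br u z.
  by move=> Az; rewrite uE (brDl lieP) (abA Aa Az) add0r.
have Ubz z : z \in A -> br (J b) z \in U.
  by move=> Az; rewrite bE // (mem_ideall lieP).
have lcU z : z \in A -> vsproj U (br (J b) z) \in lower_central (sub_br br (U := U)) k.
  elim: k {nilU} z => [|k IH] z Az; first exact: memvf.
  have Axz : br (J x) z \in A by [].
  have -> : br (J b) z = br u (br (J b) (br (J x) z)).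
    rewrite -bE // -{1}bbx -(br_mull lieP abJ two_neq0) //.
    by rewrite (br_mull lieP abJ two_neq0 (J b) z Ax).
  have -> : vsproj U (br u (br (J b) (br (J x) z)))
      = sub_br br (vsproj U u) (vsproj U (br (J b) (br (J x) z))).
    by rewrite /sub_br !vsprojK // Ubz.
  apply: mem_brv; [exact: sub_br_lie | exact: memvf | exact: IH].
have := lcU (br (J b) x) (Ader _ _); rewrite nilU bbx memv0 => /eqP b0.
by rewrite -(vsprojK (U := U) (x := b)) ?b0 ?linear0 // -{1}bbx Ubz.
Qed.

End KillingForm.

(** * The equivalence of the three conditions and its consequences *)

Theorem theorem3p5 (R : realType) (g : vectType R) (br : g -> g -> g)
    (J : 'End(g)) (lie_br : is_lie_bracket br)
    (abelian_J : is_abelian_complex_structure br J) :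
  let cond1 := is_J_semisimple br J in
  let cond2 :=
    nondegenerate_form (killing11 br J) /\
    exists n : {vspace g},
      [/\ is_nilradical br n, (n + J @: n)%VS = fullv
        & directv (n + J @: n)] in
  let cond3 := is_sum_of_J_simple_ideals br J in
  [<-> cond1; cond2; cond3] /\
  (cond1 \/ cond2 \/ cond3 ->
    [/\ is_semidirect br (derived br) (J @: derived br)%VS,
        forall U : {vspace g}, is_J_ideal br J U ->
          is_J_semisimple (sub_br br (U := U)) (sub_J J U)
      & forall U : {vspace g}, is_J_ideal br J U ->
          is_J_semisimple (quot_br br (U := U)) (quot_J J U)]).
Proof.
move=> cond1 cond2 cond3.
have two_neq0 : 2%:R != 0 :> R by rewrite pnatr_eq0.
have ssP : cond1 <-> no_abelian_J_ideal br J by apply: J_semisimpleP.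
have tf : [<-> cond1; cond2; cond3].
  tfae=> [/ssP noab | [ndB _] | simk].
  - split; first exact: killing11_nondegenerate.
    exists (derived br); split; first exact: nilradical_derived noab.
      exact: derived_addJ.
    exact/directv_addP/derived_capJ.
  - exact/is_sum_of_J_simple/nondegenerate_no_abelian.
  - exact/ssP/sum_J_simple_no_abelian.
split=> // conds.
have noab : no_abelian_J_ideal br J.
  (* The conditions are indexed from 0 in [tf], so index 0 stands for [cond1]. *)
  apply/ssP; case: conds => [|[]]; [by [] | exact: (tf 1%N 0%N).1 | exact: (tf 2%N 0%N).1].
split; first exact: semidirect_derived.
  move=> U JidU; have sU := ideal_subalgebra JidU.1.
  apply/J_semisimpleP; [exact: sub_br_lie | exact: sub_abelian_J |].
  exact: no_abelian_J_ideal_sub.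
move=> U JidU.
apply/J_semisimpleP; [exact: quot_br_lie JidU.1 | exact: quot_abelian_J |].
exact: no_abelian_J_ideal_quot.
Qed.
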